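(* Let $n$ be a sufficiently large positive integer and $u$ an integer with $n^{6}\le u\le n^{C}$ for a fixed constant $C$. Let $M_{\mathcal{R}\mathsf{H}}$ be the maximum, over $n$-element sets $X\subset[\lfloor\sqrt{nu}\rfloor]$, of the expected maxload of $\mathcal{R}\mathsf{H}_{\lfloor\sqrt{nu}\rfloor}$ on $X$; let $M_{\max}$ be the maximum over integers $k\in(\sqrt{u},nu]$ of $M_{\mathsf{SH}}(k,n)$; and let $M_{\mathbb{R}}$ be the maximum, over $n$-element sets $X\subset[u]$, of the expected maxload of $\mathbb{R}\mathsf{H}_u$ on $X$. Then \[ \Omega\!\left(\frac{M_{\mathcal{R}\mathsf{H}}}{\log\log n}\right)\le M_{\mathbb{R}}\le \mathcal{O}(M_{\max}). \]
   Context: $[N]=\{0,\dots,N-1\}$; for positive integer $N$ and real $x$, $\mathfrak{m}_N(x)$ is the unique element of $(x+N\mathbb{Z})\cap[0,N)$; $\mathbb{Z}_N^{\times}$ is the set of $k\in[N]$ coprime to $N$. All hash functions below map into $n$ bins $[n]$; the maxload on a set $X$ is the number of elements of $X$ in the fullest bin. - $\mathsf{SH}_k$: choose $c$ uniformly from $\mathbb{Z}_k^{\times}$ and place $x$ in bin $\lfloor \mathfrak{m}_k(cx)/(k/n)\rfloor$. $M_{\mathsf{SH}}(k,n)$ is the maximum over $n$-element $X\subset[k]$ of the expected maxload of $\mathsf{SH}_k$ on $X$. - $\mathcal{R}\mathsf{H}_m$ (random-modulus hashing): choose an integer $k$ uniformly from $[m/2,m]\cap\mathbb{Z}$, then hash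 with $\mathsf{SH}_k$'s hash function (random $c\in\mathbb{Z}_k^{\times}$, $x\mapsto\lfloor\mathfrak{m}_k(cx)/(k/n)\rfloor$). - $\mathbb{R}\mathsf{H}_u$ (real hashing): choose a real $a$ uniformly from $(0,1)$ and place $x\in[u]$ in bin $\lfloor \mathfrak{m}_1(ax)/(1/n)\rfloor$. *)

(* Defs.v *)
From HB Require Import structures.
From mathcomp Require Import all_boot all_order all_algebra.
From mathcomp Require Import all_classical all_reals all_analysis.
From mathcomp Require Import lra.

Set Implicit Arguments.
Unset Strict Implicit.
Unset Printing Implicit Defensive.

Import Order.TTheory GRing.Theory Num.Theory.
Import numFieldNormedType.Exports.

Local Open Scope ring_scope.

Section Hashing.
Variable R : realType.
Implicit Types (u n N k m : nat).

Definition modr N (x : R) : R := x - N%:R * (Num.floor (x / N%:R))%:~R.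

Lemma modr_bounds N (x : R) : (0 < N)%N -> 0 <= modr N x < N%:R.
Proof.
move=> N0; have N0' : (0 : R) < N%:R by rewrite ltr0n.
have /andP[h1 h2] := floor_itv (x / N%:R).
rewrite /modr subr_ge0 ltrBlDr.
move: h1; rewrite ler_pdivlMr // mulrC => -> /=.
by move: h2; rewrite ltr_pdivrMr // intrD mulrDl mul1r mulrC addrC.
Qed.

Lemma modr_unique N (x y : R) (z : int) :
  (0 < N)%N -> y = x + N%:R * z%:~R -> 0 <= y < N%:R -> y = modr N x.
Proof.
move=> N0 yE /andP[y0 yN]; have N0' : (0 : R) < N%:R by rewrite ltr0n.
suff -> : modr N x = x - N%:R * (- z)%:~R by rewrite yE mulrNz mulrN opprK.
congr (_ - _ * _%:~R); apply: floor_def.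
rewrite intrD mulrNz ler_pdivlMr // ltr_pdivrMr //.
by apply/andP; split; lra.
Qed.

(* The bin of [x] for period [N] and multiplier [a]; only values in           *)
(* {0, ..., n - 1} occur when [N] and [n] are positive.                       *)
Definition hash N n (a : R) (x : nat) : int :=
  Num.floor (modr N (a * x%:R) / (N%:R / n%:R)).

Definition maxload u n (h : nat -> int) (X : {set 'I_u}) : nat :=
  \max_(b < n) #|[set x in X | h x == b%:Z]|.

Definition unif_mean (T : finType) (A : {set T}) (f : T -> R) : R :=
  (\sum_(t in A) f t) / #|A|%:R.

(* All the quantities maximised below are nonnegative, so the default value 0 *)
(* only matters when there is no [n]-element subset of {0, ..., u - 1}.       *)
Definition max_over_subsets u n (F : {set 'I_u} -> R) : R :=
  \big[Num.max/0]_(X : {set 'I_u} | #|X| == n) F X.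

Definition units k : {set 'I_k} := [set c : 'I_k | coprime c k].

(* [u] is independent of [k]: random-modulus hashing is applied to keys which *)
(* may exceed the modulus.                                                    *)
Definition SH_mean k n u (X : {set 'I_u}) : R :=
  unif_mean (units k) (fun c : 'I_k => (maxload n (hash k n c%:R) X)%:R).

Definition M_SH k n : R := max_over_subsets n (@SH_mean k n k).

Definition moduli m : {set 'I_m.+1} := [set k : 'I_m.+1 | (m <= 2 * k)%N].

Definition RMH_mean m n u (X : {set 'I_u}) : R :=
  unif_mean (moduli m) (fun k : 'I_m.+1 => SH_mean k n X).

Definition M_RMH m n : R := max_over_subsets n (@RMH_mean m n m).

Definition M_max u n : R :=
  \big[Num.max/0]_(0 <= k < (n * u).+1 | Num.sqrt u%:R < k%:R :> R) M_SH k n.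

Definition RealH_mean n u (X : {set 'I_u}) : R :=
  Rintegral lebesgue_measure `]0, 1[%classic
    (fun a : R => (maxload n (hash 1 n a) X)%:R).

Definition M_RealH u n : R := max_over_subsets n (@RealH_mean n u).

End Hashing.

(* Main.v *)
Require Import Defs.
From HB Require Import structures.
From mathcomp Require Import all_boot all_order all_algebra.
From mathcomp Require Import all_classical all_reals all_analysis.
From mathcomp Require Import measurable_realfun zify ring lra.

Set Implicit Arguments.
Unset Strict Implicit.
Unset Printing Implicit Defensive.

Import Order.TTheory GRing.Theory Num.Theory.
Import numFieldNormedType.Exports.

Local Open Scope ring_scope.

(* If a/N and a'/N' are so close that the points a x/N and a' x/N' differ by   *)
(* at most 1/n for every key x, then each bin of one hash function is covered  *)
(* by three cyclically consecutive bins of the other, so the two maxloads      *)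
(* agree up to a factor 3.                                                     *)
(*                                                                            *)
(* Upper bound.  By Dirichlet's theorem with Q = n u, every a in (0, 1) lies   *)
(* within 1/(k Q) of a reduced fraction c/k with k <= Q, which moves each key  *)
(* by at most u/(k Q) <= 1/n.  The arcs of a given k have total length at most *)
(* 2 totient k/(k Q), so their contributions add up to O(M_max) over all k for *)
(* which k > sqrt u and X stays injective modulo k.  The other k number at     *)
(* most (n^2 + 1) sqrt u, because a k > sqrt u dividing a nonzero difference   *)
(* d < u is determined by d/k <= sqrt u; even with load n, their arcs          *)
(* contribute only O(1) as u >= n^6.                                           *)
(*                                                                            *)
(* Lower bound.  For k <= m = floor (sqrt (n u)) the arcs of radius 1/(4 m^2)  *)
(* around the reduced fractions c/k are pairwise disjoint, and on each of them *)
(* real hashing has at least a third of the maxload of SH_k with multiplier c. *)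
(* Passing from the sum over all c and k to the mean over c costs the factor   *)
(* k/totient k, which is O(ln ln n) by Mertens' second theorem.                *)

(** Both inequalities replace the real multiplier a by a nearby reduced fraction c/k.
    [maxload_hash_close] compares the two hash functions, and the resulting pointwise bounds, sums
    of weighted indicators of arcs, are integrated by [RealH_mean_le] and [RealH_mean_ge]. The upper
    bound needs the arcs to cover (0, 1), by [dirichlet_approx_coprime], and few moduli at which
    keys collide, by [card_non_separating]; [M_max_ge1] absorbs the O(1) left by the latter. The
    lower bound needs the arcs to be disjoint, in [sum_maxload_le_RealH], and [totient_lower_bound]:
    prime divisors of k up to a threshold y >= ln k contribute ln ln y + O(1) to ln (k/totient k),
    and the at most ln k/ln 2 larger ones contribute O(1). *)

(** * Mertens' estimates and the totient *)

(** Powers of distinct primes are coprime, so their divisibilities multiply. Applied to a central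
    binomial coefficient and to a factorial. *)
Lemma dvdn_prod_prime_powers (f : nat -> nat) M a b :
  (forall p, (a <= p < b)%N -> prime p -> (p ^ f p %| M)%N) ->
  (\prod_(a <= p < b | prime p) p ^ f p %| M)%N.
Proof.
elim: b => [|b IHb] dvdM; first by rewrite big_geq.
have [lab|ltba] := leqP a b; last by rewrite big_geq.
have IH : (\prod_(a <= p < b | prime p) p ^ f p %| M)%N.
  by apply: IHb => p /andP[ap pb]; apply: dvdM; rewrite ap ltnS ltnW.
rewrite big_mkcond big_nat_recr //= -big_mkcond /=.
case: ifP => pb; last by rewrite muln1.
rewrite Gauss_dvd ?IH ?dvdM ?lab ?leqnn //.
rewrite big_nat_cond; elim/big_ind: _ => [|x y cx cy|p /andP[/andP[_ ltpb] pp]].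
- by rewrite coprime1n.
- by rewrite coprimeMl cx.
- apply/coprimeXl/coprimeXr; rewrite prime_coprime // dvdn_prime2 //.
  by rewrite neq_ltn ltpb.
Qed.

Lemma prime_dvd_fact p n : prime p -> (p %| n`!)%N -> (p <= n)%N.
Proof.
move=> pp; elim: n => [|n IHn]; first by rewrite dvdn1 => /eqP p1; rewrite p1 in pp.
by rewrite factS Euclid_dvdM // => /orP[/dvdn_leq->//|/IHn/leqW].
Qed.

Lemma bin_le_exp2 n k : ('C(n, k) <= 2 ^ n)%N.
Proof.
elim: n k => [|n IHn] [|k] //; first by rewrite bin0 expn_gt0.
by rewrite binS expnS mul2n -addnn leq_add.
Qed.

(** A prime in (n, 2n] divides (2n)! but not n!, hence divides the binomial coefficient. *)
Lemma prod_primes_le_bin n :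
  (\prod_(n.+1 <= p < n.*2.+1 | prime p) p <= 'C(n.*2, n))%N.
Proof.
have le_n2n : (n <= n.*2)%N by lia.
have C0 : (0 < 'C(n.*2, n))%N by rewrite bin_gt0.
apply: dvdn_leq => //.
have := @dvdn_prod_prime_powers (fun=> 1%N) 'C(n.*2, n) n.+1 n.*2.+1.
rewrite (eq_bigr id) => [|p _]; last exact: expn1.
apply=> p /andP[np p2n] pp; rewrite expn1.
have : (p %| n.*2`!)%N by apply: dvdn_fact; rewrite prime_gt0.
rewrite -(bin_fact le_n2n).
rewrite -addnn addnK !Euclid_dvdM // => /or3P[//||] /prime_dvd_fact => /(_ pp);
  by rewrite leqNgt np.
Qed.

(** Dyadic induction: the primes in (2^k, 2^(k+1)] have product at most 2^(2^(k+1)) = 4^(2^k). *)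
Lemma primorial_exp2 k : (\prod_(0 <= p < (2 ^ k).+1 | prime p) p <= 4 ^ (2 ^ k))%N.
Proof.
elim: k => [|k IHk]; first by rewrite unlock.
rewrite (big_cat_nat (n := (2 ^ k).+1)) //=; last by rewrite ltnS leq_exp2l.
have -> : (4 ^ 2 ^ k.+1 = 4 ^ 2 ^ k * 2 ^ (2 ^ k).*2)%N.
  by rewrite -[4%N]/(2 ^ 2)%N -!expnM -expnD expnS; congr (2 ^ _)%N; lia.
apply: leq_mul => //; rewrite expnS mul2n.
exact: leq_trans (prod_primes_le_bin _) (bin_le_exp2 _ _).
Qed.

Lemma fact_leq_exp n : (n`! <= n ^ n)%N.
Proof.
elim: n => // n IHn; rewrite factS expnS leq_mul2l /=.
by apply: leq_trans IHn _; case: n => // n; rewrite leq_exp2r.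
Qed.

Section Mertens.
Variable R : realType.
Implicit Types (N k p : nat).

Let lnM_nat (I : Type) (r : seq I) (P : pred I) (F : I -> nat) :
  (forall i, P i -> (0 < F i)%N) ->
  ln ((\prod_(i <- r | P i) F i)%N%:R) = \sum_(i <- r | P i) ln (F i)%:R :> R.
Proof.
move=> F0; elim: r => [|i r IHr]; first by rewrite !big_nil ln1.
rewrite !big_cons; case: ifP => // Pi.
rewrite natrM lnM ?IHr // posrE ltr0n ?F0 //.
by rewrite prodn_cond_gt0.
Qed.

Let ler_ln_nat m n : (0 < m)%N -> (m <= n)%N -> ln m%:R <= ln n%:R :> R.
Proof. by move=> m0 mn; rewrite ler_ln ?posrE ?ltr0n ?ler_nat // (leq_trans m0). Qed.

Definition chebyshev_theta N : R := \sum_(0 <= p < N.+1 | prime p) ln p%:R.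

(** Rounding N up to a power of two at most doubles it, whence the factor 2. *)
Lemma chebyshev_theta_le N : (0 < N)%N -> chebyshev_theta N <= N%:R * (2 * ln 4).
Proof.
move=> N0; have /andP[lo hi] := @trunc_log_bounds 2 N isT N0.
set k := trunc_log 2 N in lo hi.
have le1 : chebyshev_theta N <= chebyshev_theta (2 ^ k.+1).
  rewrite /chebyshev_theta [leRHS](big_cat_nat (n := N.+1)) //=; last by rewrite ltnS ltnW.
  rewrite lerDl sumr_ge0 // => p pp; rewrite ln_ge0 // ler1n; exact: prime_gt0.
apply: le_trans le1 _.
rewrite /chebyshev_theta -lnM_nat; last exact: prime_gt0.
apply: le_trans (ler_ln_nat _ (primorial_exp2 k.+1)) _.
  by rewrite prodn_cond_gt0 //; exact: prime_gt0.
rewrite natrX lnXn ?ltr0n // -(mulr_natl (ln 4)) mulrA.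
apply: ler_wpM2r; first by rewrite ln_ge0 // ler1n.
by rewrite -natrM ler_nat expnS mulnC leq_mul.
Qed.

(** The first term of Legendre's formula shows that N! is divisible by the product of the p^(N %/
    p), so the sum of (N %/ p) ln p is at most N ln N. Replacing N %/ p by N/p costs at most ln p
    for each p, in total [chebyshev_theta N]. *)
Lemma mertens_first N : (0 < N)%N ->
  \sum_(0 <= p < N.+1 | prime p) ln p%:R / p%:R <= ln N%:R + 2 * ln 4 :> R.
Proof.
move=> N0; have N0' : 0 < N%:R :> R by rewrite ltr0n.
rewrite -(ler_pM2l N0') mulrDr.
have fact_le : ln N`!%:R <= N%:R * ln N%:R :> R.
  rewrite mulr_natl -lnXn // -natrX ler_ln_nat ?fact_gt0 //.
  exact: fact_leq_exp.
have dvd : (\prod_(0 <= p < N.+1 | prime p) p ^ (N %/ p) %| N`!)%N.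
  apply: dvdn_prod_prime_powers => p _ pp.
  rewrite pfactor_dvdn ?fact_gt0 // logn_fact // big_ltn // expn1.
  exact: leq_addr.
apply: le_trans (lerD fact_le (chebyshev_theta_le N0)).
have := ler_ln_nat _ (dvdn_leq (fact_gt0 N) dvd).
rewrite prodn_cond_gt0 => [/(_ isT)|p pp]; last by rewrite expn_gt0 prime_gt0.
rewrite lnM_nat => [le_fact|p pp]; last by rewrite expn_gt0 prime_gt0.
apply: le_trans (lerD le_fact (lexx _)).
rewrite /chebyshev_theta -big_split mulr_sumr; apply: ler_sum => p pp /=.
have p0 : 0 < p%:R :> R by rewrite ltr0n prime_gt0.
rewrite natrX lnXn // -mulrSr -(mulr_natr _ (_ %/ _).+1) mulrCA.
apply: ler_wpM2l; first by rewrite ln_ge0 // ler1n prime_gt0.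
by rewrite ler_pdivrMr // -natrM ler_nat ltnW // ltn_ceil // prime_gt0.
Qed.

Let ln_nat_gt0 n : (1 < n)%N -> 0 < ln n%:R :> R.
Proof. by move=> n1; rewrite ln_gt0 // ltr1n. Qed.

(* Abel summation from [mertens_first]: the quantity                           *)
(* [sum 1/p - A(N)/ln N - ln ln N + (2 ln 4)/ln N], with [A(N) = sum ln p / p], *)
(* does not increase with [N], because [1 - L/L' <= ln (L'/L)].                *)
Lemma mertens_second : exists K : R, forall N, (1 < N)%N ->
  \sum_(0 <= p < N.+1 | prime p) p%:R^-1 <= ln (ln N%:R) + K.
Proof.
(* [K] makes both sides of [abel] vanish at N = 2. *)
pose c : R := 2 * ln 4; pose K : R := c / ln 2 - ln (ln 2).
pose S N : R := \sum_(0 <= p < N.+1 | prime p) p%:R^-1.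
pose A N : R := \sum_(0 <= p < N.+1 | prime p) ln p%:R / p%:R.
have c0 : 0 <= c by rewrite mulr_ge0 // ln_ge0 // ler1n.
have abel N : (1 < N)%N ->
  S N - A N / ln N%:R <= ln (ln N%:R) - c / ln N%:R + K.
  elim: N => // N IHN; rewrite ltnS leq_eqVlt => /predU1P[<-|N1].
    rewrite /S /A unlock /= !addr0 mulrAC divff ?mul1r ?subrr ?lt0r_neq0 ?ln_nat_gt0 //.
    by rewrite /K; lra.
  have L0 := ln_nat_gt0 N1; have L0' := ln_nat_gt0 (leqW N1).
  have AN := mertens_first (ltnW N1).
  set L := ln N%:R in L0 AN IHN; set L' := ln N.+1%:R in L0' *.
  have LL' : L <= L' by rewrite /L ler_ln_nat // ltnW.
  (* If N+1 is prime, it adds 1/(N+1) to both [S] and [A / L'], so only the change from [L] to [L']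
     matters. *)
  have -> : S N.+1 - A N.+1 / L' = S N - A N / L'.
    rewrite /S /A [in X in X - _]big_mkcond [in X in _ - X]big_mkcond /=.
    rewrite !(big_nat_recr N.+1) //= -!big_mkcond /=; case: ifP => _; last by rewrite !addr0.
    by rewrite -/L' mulrDl mulrAC divff ?mul1r ?lt0r_neq0 // opprD addrACA subrr addr0.
  have ln_step : ln L + (1 - L / L') <= ln L'.
    have : ln (L / L') <= L / L' - 1.
      rewrite -{1}(subrK 1 (L / L')) addrC; apply: le_ln1Dx.
      by rewrite ltrBrDl subrr divr_gt0.
    by rewrite ln_div ?posrE //; lra.
  have AN' : A N * (L^-1 - L'^-1) <= (L + c) * (L^-1 - L'^-1).
    by apply: ler_wpM2r => //; rewrite subr_ge0 lef_pV2 ?posrE.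
  have LV : L * L^-1 = 1 by rewrite divff ?lt0r_neq0.
  by have := IHN N1; lra.
exists (1 + K) => N N1; have L0 := ln_nat_gt0 N1.
have := abel _ N1; have := mertens_first (ltnW N1); rewrite -/c -/(A N) -/(S N) => AN.
have : A N / ln N%:R <= (ln N%:R + c) / ln N%:R by rewrite ler_pM2r ?invr_gt0.
by rewrite mulrDl divff ?lt0r_neq0 //; lra.
Qed.

(** The differences 1/(p-1) - 1/p telescope when extended to all integers from 2 to N. *)
Lemma sum_inv_pred_primes_le N : (0 < N)%N ->
  \sum_(0 <= p < N.+1 | prime p) p.-1%:R^-1 <=
  \sum_(0 <= p < N.+1 | prime p) p%:R^-1 + (1 - N%:R^-1) :> R.
Proof.
elim: N => // N; case: N => [_ _|N IHN _].
  by rewrite unlock /= invr1 subrr addr0.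
move/(_ isT): IHN; rewrite big_mkcond [in leRHS]big_mkcond /=.
rewrite [in X in _ -> X]big_mkcond [in X in _ -> _ <= X]big_mkcond /=.
rewrite !(big_nat_recr N.+2) //=.
have : N.+2%:R^-1 <= N.+1%:R^-1 :> R by rewrite lef_pV2 ?posrE ?ltr0n ?ler_nat.
move: (\sum_(0 <= i < _) _) (\sum_(0 <= i < _) _) => s t.
by move: (N.+2%:R^-1) (N.+1%:R^-1) => v w; case: ifP => _ ? ?; lra.
Qed.

Lemma exp2_size_primes k : (0 < k)%N -> (2 ^ size (primes k) <= k)%N.
Proof.
move=> k0; rewrite {2}(prod_prime_decomp k0) prime_decompE big_map /=.
have -> : (2 ^ size (primes k) = \prod_(p <- primes k) 2)%N.
  by rewrite big_const_seq count_predT iter_muln_1.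
rewrite big_seq [leqRHS]big_seq; apply: leq_prod => p pk.
apply: leq_trans (leq_pexp2l _ (_ : 0 < logn p k)%N).
- by move: pk; rewrite mem_primes => /andP[/prime_gt1].
- by move: pk; rewrite mem_primes => /andP[/prime_gt0].
- by rewrite logn_gt0.
Qed.

(** k/totient k is the product of 1 + 1/(p-1) over the primes p dividing k, and 1 + x <= exp x. *)
Lemma natr_le_totient k : (0 < k)%N ->
  k%:R <= (totient k)%:R * expR (\sum_(p <- primes k) p.-1%:R^-1) :> R.
Proof.
move=> k0; rewrite totientE // {1}(prod_prime_decomp k0) prime_decompE big_map /=.
rewrite expR_sum !natr_prod -big_split /= big_seq [leRHS]big_seq.
apply: ler_prod => p; rewrite mem_primes => /and3P[pp _ pk]; rewrite ler0n /=.
have l0 : (0 < logn p k)%N by rewrite logn_gt0 mem_primes pp k0.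
rewrite -{1}(prednK l0) expnS !natrM -mulrA mulrCA [leRHS]mulrC -mulrA.
rewrite mulrA; apply: ler_wpM2r; first exact: ler0n.
have p1 : 0 < p.-1%:R :> R by rewrite ltr0n -subn1 subn_gt0 prime_gt1.
apply: le_trans (ler_wpM2l (ltW p1) (expR_ge1Dx _)).
by rewrite mulrDr mulr1 divff ?lt0r_neq0 // natr1 prednK // prime_gt0.
Qed.

(** Split the prime divisors of k at y. Those up to y give at most ln ln y + K0 + 1 by
    [mertens_second]; the larger ones number at most ln k/ln 2 <= y/ln 2, and each gives at most
    1/y. *)
Lemma totient_lower_bound : exists K : R, 0 < K /\ forall k y : nat,
  (0 < k)%N -> (2 < y)%N -> ln k%:R <= y%:R :> R ->
  k%:R <= K * ln y%:R * (totient k)%:R.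
Proof.
have [K0 mertens] := mertens_second.
exists (expR (K0 + 1 + (ln 2)^-1)); split=> [|k y k0 y2 ky]; first exact: expR_gt0.
have y0 : (0 < y)%N by lia.
have ln2 : 0 < ln 2 :> R by exact: ln_nat_gt0.
apply: le_trans (natr_le_totient k0) _; rewrite mulrC.
apply: ler_wpM2r; first exact: ler0n.
rewrite -[ln y%:R]lnK ?posrE ?ln_nat_gt0 //; last by lia.
rewrite -expRD ler_expR (bigID (fun p => p <= y)%N) /=.
have small : \sum_(p <- primes k | (p <= y)%N) p.-1%:R^-1
    <= \sum_(0 <= p < y.+1 | prime p) p.-1%:R^-1 :> R.
  rewrite -big_filter (perm_big [seq p <- index_iota 0 y.+1 | p \in primes k]).
    rewrite big_filter big_mkcond [leRHS]big_mkcond; apply: ler_sum => p _ /=.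
    case: ifP => [|_]; first by rewrite mem_primes => /andP[-> _].
    by case: ifP => // _; rewrite invr_ge0.
  apply: uniq_perm; rewrite ?filter_uniq ?primes_uniq ?iota_uniq // => p.
  by rewrite !mem_filter mem_index_iota /= ltnS andbC.
have large : \sum_(p <- primes k | ~~ (p <= y)%N) p.-1%:R^-1 <= (ln 2)^-1 :> R.
  apply: (@le_trans _ _ (\sum_(p <- primes k) y%:R^-1)).
    rewrite big_mkcond; apply: ler_sum => p _.
    case: ifPn => [py|_]; last by rewrite invr_ge0.
    by rewrite lef_pV2 ?posrE ?ltr0n ?ler_nat //; lia.
  rewrite big_const_seq count_predT iter_addr_0 -(mulr_natl y%:R^-1) ler_pdivrMr ?ltr0n //.
  rewrite mulrC ler_pdivlMr // mulr_natl -lnXn // -natrX.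
  by apply: le_trans ky; rewrite ler_ln_nat ?expn_gt0 ?exp2_size_primes.
have := sum_inv_pred_primes_le y0; have := mertens y (ltnW y2).
have : 0 <= y%:R^-1 :> R by rewrite invr_ge0.
lra.
Qed.

End Mertens.

(** * Maxloads of close multipliers *)

Section Maxload.
Implicit Types (u v n : nat) (h : nat -> int).

Lemma card_bin_le_maxload u n h (X : {set 'I_u}) (z : int) : 0 <= z < n%:Z ->
  (#|[set x in X | h x == z]| <= maxload n h X)%N.
Proof.
case: z => // b; rewrite lez_nat ltz_nat => /andP[_ bn].
exact: (leq_bigmax (Ordinal bn)).
Qed.

Lemma maxload_le_card u n h (X : {set 'I_u}) : (maxload n h X <= #|X|)%N.
Proof.
apply/bigmax_leqP => b _; apply: subset_leq_card.
by apply/fintype.subsetP => x; rewrite inE => /andP[].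
Qed.

Lemma maxload_gt0 u n h (X : {set 'I_u}) : (0 < #|X|)%N ->
  (forall x, 0 <= h x < n%:Z) -> (0 < maxload n h X)%N.
Proof.
move=> /card_gt0P[x xX] hn; apply: leq_trans (@card_bin_le_maxload _ _ h X _ (hn x)).
by apply/card_gt0P; exists x; rewrite inE xX eqxx.
Qed.

(** Serves both to reduce keys modulo k and to view them in a larger key range. *)
Lemma maxload_imset u v n h h' (f : 'I_u -> 'I_v) (X : {set 'I_u}) :
  {in X &, injective f} -> {in X, forall x : 'I_u, h x = h' (f x)} ->
  maxload n h X = maxload n h' (f @: X).
Proof.
move=> injf hh'; apply: eq_bigr => b _.
rewrite -(@card_in_imset _ _ f) => [|x y]; last first.
  by rewrite !inE => /andP[xX _] /andP[yX _]; exact: injf.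
apply: eq_card => y; rewrite inE; apply/imsetP/andP => [[x]|[/imsetP[x xX ->] hy]].
  by rewrite inE => /andP[xX hx] ->; rewrite imset_f // -hh'.
by exists x => //; rewrite inE xX hh'.
Qed.

(** A key with f x = b modulo n has g x equal to b, b - 1 or b + 1 modulo n. Working with residues
    treats the wrap-around at the last bin like any other; for small n the three bins may coincide,
    which the union bound allows. *)
Lemma maxload_modz_le3 u n (f g : nat -> int) (X : {set 'I_u}) : (0 < n)%N ->
  {in X, forall x : 'I_u, `|f x - g x| <= 1} ->
  (maxload n (fun x => (f x %% n)%Z) X <= 3 * maxload n (fun x => (g x %% n)%Z) X)%N.
Proof.
move=> n0 fg; apply/bigmax_leqP => b _.
pose B j := [set x in X | (g x %% n)%Z == (j %% n)%Z].
have BM j : (#|B j| <= maxload n (fun x => (g x %% n)%Z) X)%N.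
  by apply: card_bin_le_maxload; rewrite modz_ge0 ?ltz_pmod // lt0r_neq0.
apply: (@leq_trans #|B b%:Z :|: B (b%:Z - 1) :|: B (b%:Z + 1)|); last first.
  rewrite mulSn mulSn mul1n addnA.
  apply: leq_trans (leq_card_setU _ _) _; apply: leq_add => //.
  by apply: leq_trans (leq_card_setU _ _) _; apply: leq_add.
apply/subset_leq_card/fintype.subsetP => x; rewrite !inE => /andP[xX /eqP fb].
rewrite xX /= -fb modz_mod !modzDml; have := fg _ xX.
move: (f x) (g x) => s t st.
have /or3P[/eqP->|/eqP->|/eqP->] : [|| t == s, t == s - 1 | t == s + 1].
  move: st; clear; rewrite ler_norml => /andP[]; lia.
- by rewrite eqxx.
- by rewrite eqxx orbT.
- by rewrite eqxx !orbT.
Qed.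

End Maxload.

Section Hash.
Variable R : realType.
Implicit Types (a s t : R) (u n N k x : nat).

(** Reducing a x modulo N shifts n a x/N by a multiple of n. In this form, hash functions of
    different periods become comparable. *)
Lemma hashE N n a x : (0 < N)%N -> (0 < n)%N ->
  hash N n a x = (Num.floor (n%:R * (a * x%:R / N%:R)) %% n)%Z.
Proof.
move=> N0 n0; have N0' : 0 < N%:R :> R by rewrite ltr0n.
have n0' : 0 < n%:R :> R by rewrite ltr0n.
set y := a * x%:R; set z := Num.floor (y / N%:R).
have E : modr N y / (N%:R / n%:R) = n%:R * (y / N%:R) + (- (z * n%:Z))%:~R.
  rewrite /modr -/z intrN intrM; field; by rewrite !lt0r_neq0.
have /andP[lo hi] := modr_bounds y N0.
have hE : hash N n a x = Num.floor (n%:R * (y / N%:R)) - z * n%:Z.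
  by rewrite /hash E floorDrz ?intr_int // intrKfloor.
have bnd : 0 <= hash N n a x < n%:Z.
  rewrite /hash floor_ge0 floor_lt_int -/y; apply/andP; split.
    by rewrite divr_ge0 // divr_ge0 // ltW.
  by rewrite ltr_pdivrMr ?divr_gt0 // mulrCA divff ?mulr1 // lt0r_neq0.
rewrite -[LHS](modz_small bnd) hE; apply/eqP.
by rewrite addrC -mulNr modzMDl.
Qed.

Lemma hash_bounds N n a x : (0 < N)%N -> (0 < n)%N -> 0 <= hash N n a x < n%:Z.
Proof. by move=> N0 n0; rewrite hashE // modz_ge0 ?ltz_pmod // lt0r_neq0. Qed.

Lemma floor_close s t : `|s - t| <= 1 -> `|Num.floor s - Num.floor t| <= 1.
Proof.
rewrite !ler_norml => /andP[lo hi].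
have /andP[s1 s2] := floor_itv s; have /andP[t1 t2] := floor_itv t.
have : (Num.floor s)%:~R < (Num.floor t + 2)%:~R :> R.
  by rewrite intrD; move: t2; rewrite intrD; lra.
have : (Num.floor t)%:~R < (Num.floor s + 2)%:~R :> R.
  by rewrite intrD; move: s2; rewrite intrD; lra.
rewrite !ltr_int; lia.
Qed.

Lemma maxload_hash_close u N N' n a a' (X : {set 'I_u}) :
  (0 < N)%N -> (0 < N')%N -> (0 < n)%N ->
  {in X, forall x : 'I_u, `|a * x%:R / N%:R - a' * x%:R / N'%:R| <= n%:R^-1} ->
  (maxload n (hash N n a) X <= 3 * maxload n (hash N' n a') X)%N.
Proof.
move=> N0 N'0 n0 aa'.
pose g N a := fun x => Num.floor (n%:R * (a * x%:R / N%:R) : R).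
have E M b : (0 < M)%N -> maxload n (hash M n b) X = maxload n (fun x => (g M b x %% n)%Z) X.
  move=> M0; apply: eq_bigr => i _; apply: eq_card => x; by rewrite !inE hashE.
rewrite !E //; apply: maxload_modz_le3 => // x xX; apply: floor_close.
rewrite -mulrBr normrM ger0_norm // -ler_pdivlMl ?ltr0n // mulr1; exact: aa'.
Qed.

(** As c is an integer, changing x by a multiple of k changes n c x/k by a multiple of n. *)
Lemma hash_modn k n (c x : nat) : (0 < k)%N -> (0 < n)%N ->
  hash k n (c%:R : R) x = hash k n (c%:R : R) (x %% k).
Proof.
move=> k0 n0; rewrite !hashE // {1}(divn_eq x k).
have -> : n%:R * (c%:R * (x %/ k * k + x %% k)%:R / k%:R)
    = n%:R * (c%:R * (x %% k)%:R / k%:R) + ((c * (x %/ k))%:Z * n%:Z)%:~R :> R.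
  rewrite intrM -!pmulrn natrM natrD natrM; field; by rewrite pnatr_eq0 -lt0n.
rewrite floorDrz ?intr_int // intrKfloor addrC.
exact: modzMDl.
Qed.

Lemma card_units k : #|units k| = totient k.
Proof.
rewrite totient_count_coprime big_mkord -sum1_card big_mkcond /=.
by apply: eq_bigr => c _; rewrite inE coprime_sym; case: coprime.
Qed.

Lemma sum_maxload_units u k n (X : {set 'I_u}) : (0 < k)%N ->
  \sum_(c < k | coprime c k) (maxload n (hash k n (c%:R : R)) X)%:R
    = (totient k)%:R * SH_mean R k n X.
Proof.
move=> k0; rewrite /SH_mean /unif_mean card_units mulrC divfK.
  by apply: eq_bigl => c; rewrite inE.
by rewrite pnatr_eq0 -lt0n totient_gt0.
Qed.

End Hash.

(** * Dirichlet approximation *)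

Section Dirichlet.
Variable R : realType.

(** Pigeonhole: the Q + 1 fractional parts of j a, for j from 0 to Q, fall into Q intervals of
    length 1/Q. *)
Lemma dirichlet_approx (a : R) (Q : nat) : (0 < Q)%N ->
  exists (k : nat) (z : int), (0 < k <= Q)%N /\ `|k%:R * a - z%:~R| < Q%:R^-1.
Proof.
case: Q => // Q _; have Q0 : 0 < Q.+1%:R :> R by rewrite ltr0n.
pose frac (j : nat) : R := j%:R * a - (Num.floor (j%:R * a))%:~R.
have frac_itv j : 0 <= frac j < 1.
  by have /andP[] := floor_itv (j%:R * a); rewrite /frac intrD; lra.
pose f (j : 'I_Q.+2) : 'I_Q.+1 := inord (Num.truncn (Q.+1%:R * frac j)).
have fE j : (f j)%:R <= Q.+1%:R * frac j < (f j)%:R + 1.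
  have /andP[f0 f1] := frac_itv j.
  have T0 : 0 <= Q.+1%:R * frac j by rewrite mulr_ge0 // ltW.
  have /andP[t0 t1] := truncn_itv T0.
  rewrite inordK ?natr1 ?t0 ?t1 // -(ltr_nat R).
  apply: le_lt_trans t0 _; by rewrite gtr_pMr.
have /injectivePn[i [j ij fij]] : ~~ injectiveb f.
  apply/negP => /injectiveP /leq_card; by rewrite !card_ord ltnn.
wlog ltij : i j ij fij / (i < j)%N.
  move=> W; have [lt|lt|/val_inj ijE] := ltngtP i j; first exact: W ij fij lt.
    by apply: W lt; rewrite 1?eq_sym.
  by rewrite ijE eqxx in ij.
exists (j - i)%N, (Num.floor (j%:R * a) - Num.floor (i%:R * a)); split.
  by rewrite subn_gt0 ltij; have := ltn_ord j; lia.
rewrite -(ltr_pM2l Q0) divff ?lt0r_neq0 // -{1}(ger0_norm (ltW Q0)) -normrM.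
have -> : (j - i)%:R * a - (Num.floor (j%:R * a) - Num.floor (i%:R * a))%:~R
    = frac j - frac i.
  by rewrite natrB 1?ltnW // intrB /frac; ring.
have := fE i; have := fE j; rewrite fij ltr_norml [_ * (frac j - _)]mulrBr.
move: (_ * frac i) (_ * frac j) (_%:R) => s t v /andP[? ?] /andP[? ?].
by apply/andP; split; lra.
Qed.

(** Cancelling the gcd keeps the fraction and lowers k, which only relaxes the error bound. *)
Lemma dirichlet_approx_coprime (a : R) (Q : nat) : 0 < a < 1 -> (0 < Q)%N ->
  exists k c : nat, [/\ (0 < k <= Q)%N, (c <= k)%N, coprime c k
    & `|a - c%:R / k%:R| <= (k%:R * Q%:R)^-1].
Proof.
move=> /andP[a0 a1] Q0; have [k [z [/andP[k0 kQ] kaz]]] := dirichlet_approx a Q0.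
have Q0' : 0 < Q%:R :> R by rewrite ltr0n.
have k0' : 0 < k%:R :> R by rewrite ltr0n.
have Q1 : Q%:R^-1 <= 1 :> R by rewrite invf_le1 // ler1n.
have ka0 : 0 < k%:R * a by rewrite mulr_gt0.
have kak : k%:R * a < k%:R by rewrite gtr_pMr.
move: (kaz); rewrite ltr_norml => /andP[z1 z2].
(* As k a > 0 and the error is below 1/Q <= 1, the numerator is nonnegative. *)
have zgtN1 : (-1)%:~R < z%:~R :> R by lra.
case: z kaz z1 z2 zgtN1 => c kaz z1 z2; rewrite ltr_int // => _.
rewrite -pmulrn in kaz z1 z2.
have ck : (c <= k)%N.
  rewrite -ltnS -(ltr_nat R) -natr1; lra.
have g0 : (0 < gcdn c k)%N by rewrite gcdn_gt0 k0 orbT.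
set g := gcdn c k in g0 *.
have gc : (c %/ g * g = c)%N by rewrite divnK // dvdn_gcdl.
have gk : (k %/ g * g = k)%N by rewrite divnK // dvdn_gcdr.
have k'0 : (0 < k %/ g)%N by move: k0; rewrite -{1}gk muln_gt0 => /andP[].
exists (k %/ g)%N, (c %/ g)%N; split.
- by rewrite k'0 (leq_trans (leq_div _ _)).
- exact: leq_div2r.
- by rewrite /coprime -(eqn_pmul2r g0) muln_gcdl gc gk mul1n.
have g0' : g%:R != 0 :> R by rewrite pnatr_eq0 -lt0n.
have -> : (c %/ g)%:R / (k %/ g)%:R = c%:R / k%:R :> R.
  by rewrite -{2}gc -{2}gk !natrM -mulf_div divff // mulr1.
have -> : a - c%:R / k%:R = (k%:R * a - c%:R) / k%:R.
  by rewrite mulrBl mulrAC divff ?lt0r_neq0 // mul1r.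
rewrite normrM normfV [`|k%:R|]ger0_norm ?(ltW k0') //.
apply: (@le_trans _ _ (Q%:R^-1 / k%:R)).
  by apply: ler_wpM2r; [rewrite invr_ge0 ltW | exact: ltW].
rewrite -invfM mulrC lef_pV2 ?posrE ?mulr_gt0 ?ltr0n //.
by rewrite ler_pM2r // ler_nat leq_div.
Qed.

End Dirichlet.

(** * Integrating the maxload over arcs *)

Section Integration.
Local Open Scope classical_set_scope.
Variable R : realType.
Local Notation mu := (@lebesgue_measure R).
Local Notation I01 := `]0, 1[%classic.

(** By [hashE], a bin is a countable union of preimages of intervals under a linear map. *)
Lemma measurable_bin n (z : int) (x : nat) : (0 < n)%N ->
  measurable [set a : R | hash 1 n a x == z]%classic.
Proof.
move=> n0.
pose g (a : R) := n%:R * (a * x%:R / 1).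
have mg : measurable_fun setT g.
  apply: measurable_funM => //; apply: measurable_funM => //.
  exact: measurable_funM.
have -> : [set a | hash 1 n a x == z]%classic =
    \bigcup_(j in [set j : int | (j %% n)%Z == z]) (g @^-1` `[j%:~R, (j + 1)%:~R[).
  apply/seteqP; split => [a|a [j]] /=; rewrite hashE //.
    by move=> ?; exists (Num.floor (g a)) => //=; rewrite in_itv /= floor_itv.
  by move=> jz; rewrite in_itv /= => /floor_def gj; rewrite -[_ * _]/(g a) gj.
rewrite bigcup_mkcond; apply: countable_bigcupT_measurable => // j.
by case: ifP => // _; rewrite -[X in measurable X]setTI; apply: mg.
Qed.

Lemma measurable_maxload u n (X : {set 'I_u}) : (0 < n)%N ->
  measurable_fun setT (fun a : R => (maxload n (hash 1 n a) X)%:R : R).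
Proof.
move=> n0.
have -> : (fun a : R => (maxload n (hash 1 n a) X)%:R : R) =
    (fun a => \big[Num.max/0]_(b < n)
      \sum_(x in X) \1_[set a : R | hash 1 n a x == b%:Z] a).
  apply/funext => a; rewrite /maxload (big_morph _ (@natr_max R) (erefl _)).
  apply: eq_bigr => b _; rewrite -sum1_card natr_sum big_mkcond [RHS]big_mkcond /=.
  apply: eq_bigr => x _; rewrite inE indicE; case: (x \in X) => //=.
  case: ifPn => h; first by rewrite mem_set.
  by rewrite memNset //=; apply/negP.
elim: (index_enum _) => [|b r IHr].
  by under eq_fun do rewrite big_nil; exact: measurable_cst.
under eq_fun do rewrite big_cons.
apply: measurable_maxr => //.
under eq_fun do rewrite big_mkcond.
apply: measurable_sum => x; case: (x \in X) => //.
by apply: measurable_indic; exact: measurable_bin.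
Qed.

Lemma integral_weighted_indic (I : finType) (P : pred I) (w : I -> R) (A : I -> set R) :
  (forall i, P i -> 0 <= w i) -> (forall i, measurable (A i)) ->
  (\int[mu]_(a in I01) (\sum_(i | P i) w i * \1_(A i) a)%:E
   = \sum_(i | P i) (w i)%:E * mu (A i `&` I01))%E.
Proof.
move=> w0 mA.
transitivity (\int[mu]_(a in I01)
    (\sum_(i <- index_enum I) if P i then (w i * \1_(A i) a)%:E else 0))%E.
  by apply: eq_integral => a _; rewrite -sumEFin big_mkcond.
transitivity (\sum_(i <- index_enum I)
    if P i then (w i)%:E * mu (A i `&` I01) else 0)%E; last by rewrite -big_mkcond.
rewrite ge0_integral_sum //; last 2 first.
- move=> i; case: (P i); last exact: measurable_cst.
  apply/measurable_EFinP.
  by apply: measurable_funM => //; apply: measurable_indic; apply: mA.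
- by move=> i a _; case: ifP => // Pi; rewrite lee_fin mulr_ge0 // w0.
apply: eq_bigr => i _; case: ifP => Pi; last by rewrite integral0.
under eq_integral do rewrite EFinM.
rewrite ge0_integralZl_EFin //; last 2 first.
- by apply/measurable_EFinP; apply: measurable_indic; apply: mA.
- exact: w0.
by rewrite integral_indic //; apply: mA.
Qed.

(** The bound itself makes the extended integral finite, so [fine] inside [Rintegral] is
    faithful. *)
Lemma ge0_le_Rintegral_fin (f : R -> R) (x : R) :
  (forall a, I01 a -> 0 <= f a) ->
  (\int[mu]_(a in I01) (f a)%:E <= x%:E)%E -> Rintegral mu I01 f <= x.
Proof.
move=> f0 fx; rewrite /Rintegral -lee_fin fineK // ge0_fin_numE.
  exact: le_lt_trans fx (ltry _).
by apply: integral_ge0 => a /f0; rewrite lee_fin.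
Qed.

Lemma measure_itvcc (l r : R) : l <= r -> mu `[l, r] = (r - l)%:E.
Proof.
move=> lr; rewrite lebesgue_measure_itv /= lte_fin; case: ltP => [_|rl].
  by rewrite EFinD EFinN.
by rewrite (@le_anti _ _ l r) ?lr ?subrr.
Qed.

(** The arcs may leave (0, 1), as those around 0 and 1 do; cutting them off only lowers the
    integral. *)
Lemma RealH_mean_le u n (X : {set 'I_u}) (I : finType) (P : pred I) (w l r : I -> R) :
  (0 < n)%N -> (forall i, P i -> 0 <= w i) -> (forall i, P i -> l i <= r i) ->
  (forall a, 0 < a < 1 ->
    (maxload n (hash 1 n a) X)%:R <= \sum_(i | P i) w i * \1_(`[l i, r i]) a) ->
  RealH_mean R n X <= \sum_(i | P i) w i * (r i - l i).
Proof.
move=> n0 w0 lr ub; apply: ge0_le_Rintegral_fin => //.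
apply: (@le_trans _ _ (\int[mu]_(a in I01)
    (\sum_(i | P i) w i * \1_(`[l i, r i]) a)%:E)%E).
  apply: ge0_le_integral => //.
  - apply/measurable_EFinP; apply: measurable_funTS; exact: measurable_maxload.
  - apply/measurable_EFinP; apply: measurable_funTS.
    under eq_fun do rewrite big_mkcond.
    apply: measurable_sum => i; case: (P i); last exact: measurable_cst.
    by apply: measurable_funM => //; apply: measurable_indic.
rewrite integral_weighted_indic // -sumEFin; apply: lee_sum => i Pi.
rewrite EFinM; apply: lee_wpmul2l; first by rewrite lee_fin w0.
apply: le_trans (_ : (mu `[l i, r i] <= _)%E); last by rewrite measure_itvcc // lr.
by apply: le_measure; rewrite ?inE //; apply: measurableI.
Qed.

(** Here the arcs must lie inside (0, 1) to count with their full length. The maxload is at most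
    [#|X|], so its integral is finite. *)
Lemma RealH_mean_ge u n (X : {set 'I_u}) (I : finType) (P : pred I) (w l r : I -> R) :
  (0 < n)%N -> (forall i, P i -> 0 <= w i) ->
  (forall i, P i -> [/\ 0 < l i, l i <= r i & r i < 1]) ->
  (forall a, 0 < a < 1 ->
    \sum_(i | P i) w i * \1_(`[l i, r i]) a <= (maxload n (hash 1 n a) X)%:R) ->
  \sum_(i | P i) w i * (r i - l i) <= RealH_mean R n X.
Proof.
move=> n0 w0 lr lb; rewrite /RealH_mean /Rintegral -lee_fin fineK; last first.
  rewrite ge0_fin_numE; last by apply: integral_ge0 => a _; rewrite lee_fin.
  apply: (@le_lt_trans _ _ (\int[mu]_(a in I01) (#|X|%:R : R)%:E)%E).
    apply: ge0_le_integral => //.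
      - apply/measurable_EFinP; apply: measurable_funTS; exact: measurable_maxload.
    - by move=> a _; rewrite lee_fin ler_nat maxload_le_card.
  by rewrite integral_cst //= lebesgue_measure_itv /= lte01 -EFinB -EFinM ltry.
apply: (@le_trans _ _ (\int[mu]_(a in I01)
    (\sum_(i | P i) w i * \1_(`[l i, r i]) a)%:E)%E); last first.
  apply: ge0_le_integral => //.
  - by move=> a _; rewrite lee_fin sumr_ge0 // => i Pi; rewrite mulr_ge0 // w0.
  - apply/measurable_EFinP; apply: measurable_funTS.
    under eq_fun do rewrite big_mkcond.
    apply: measurable_sum => i; case: (P i); last exact: measurable_cst.
    by apply: measurable_funM => //; apply: measurable_indic.
  - apply/measurable_EFinP; apply: measurable_funTS; exact: measurable_maxload.
rewrite integral_weighted_indic // -sumEFin; apply: lee_sum => i Pi.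
have [l0 lri r1] := lr i Pi.
rewrite setIidl ?EFinM ?measure_itvcc //.
move=> a; rewrite /= !in_itv /= => /andP[la ar].
by rewrite (lt_le_trans l0 la) (le_lt_trans ar r1).
Qed.

End Integration.

(** * Upper bound *)

Section UpperBound.
Variable R : realType.
Implicit Types (u n k : nat).

Definition separates u k (X : {set 'I_u}) : bool :=
  [forall x in X, forall y in X, (x == y %[mod k]) ==> (x == y)].

Lemma separatesP u k (X : {set 'I_u}) :
  reflect {in X &, forall x y : 'I_u, x = y %[mod k] -> x = y} (separates k X).
Proof.
apply: (iffP idP) => [/forall_inP sep x y xX yX xy|sep].
  by apply/eqP; move/forall_inP/(_ y yX)/implyP: (sep x xX); apply; apply/eqP.
apply/forall_inP => x xX; apply/forall_inP => y yX; apply/implyP => /eqP xy.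
by apply/eqP; exact: sep.
Qed.

(** Reduction modulo k turns [X] into an n-element subset of [k] with the same loads, by
    [hash_modn]. *)
Lemma SH_mean_le_M_SH u n k (X : {set 'I_u}) :
  (0 < k)%N -> (0 < n)%N -> #|X| = n -> separates k X -> SH_mean R k n X <= M_SH R k n.
Proof.
move=> k0 n0 Xn /separatesP sep.
pose f (x : 'I_u) : 'I_k := Ordinal (ltn_pmod x k0).
have injf : {in X &, injective f}.
  by move=> x y xX yX /(congr1 val) /= xy; apply: sep.
have -> : SH_mean R k n X = SH_mean R k n (f @: X).
  rewrite /SH_mean /unif_mean; congr (_ / _); apply: eq_bigr => c _; congr _%:R.
  by apply: maxload_imset => // x _; rewrite hash_modn.
apply: (@le_bigmax_cond _ _ _ _ _ (fun Y : {set 'I_k} => #|Y| == n)).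
by rewrite card_in_imset ?Xn.
Qed.

Lemma SH_mean_ge1 u n k (X : {set 'I_u}) :
  (0 < k)%N -> (0 < n)%N -> (0 < #|X|)%N -> 1 <= SH_mean R k n X.
Proof.
move=> k0 n0 X0; have t0 : 0 < (totient k)%:R :> R by rewrite ltr0n totient_gt0.
rewrite -(ler_pM2l t0) mulr1 -sum_maxload_units // -card_units -sum1_card natr_sum.
rewrite [leLHS](eq_bigl (fun c : 'I_k => coprime c k)) => [|c]; last by rewrite inE.
apply: ler_sum => c _; rewrite ler_nat maxload_gt0 // => x.
exact: hash_bounds.
Qed.

Lemma M_SH_le_M_max u n k : (k <= n * u)%N -> Num.sqrt u%:R < k%:R :> R ->
  M_SH R k n <= M_max R u n.
Proof.
move=> kQ uk; apply: (@le_bigmax_seq _ _ _ _ _ k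
  (fun k => Num.sqrt u%:R < k%:R :> R)) => //.
by rewrite mem_index_iota.
Qed.

(** Take the modulus k = u and the keys below n. This lets additive constants be absorbed into
    [M_max]. *)
Lemma M_max_ge1 u n : (1 < n)%N -> (n <= u)%N -> 1 <= M_max R u n.
Proof.
move=> n1 nu; have u1 := leq_trans n1 nu; have n0 := ltnW n1.
have u0 : (0 < u)%N by exact: ltnW.
apply: le_trans (@M_SH_le_M_max u n u _ _); last 2 first.
- by rewrite leq_pmull.
- have u0' : 0 < u%:R :> R by rewrite ltr0n.
  rewrite -[ltRHS](ger0_norm (ltW u0')) -sqrtr_sqr ltr_sqrt ?exprn_gt0 //.
  by rewrite expr2 ltr_pMl // ltr1n.
have Xn : #|[set widen_ord nu i | i : 'I_n]| = n.
  by rewrite card_imset ?card_ord // => i j /(congr1 val) /= /val_inj.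
apply: le_trans (SH_mean_le_M_SH u0 n0 Xn _); first by apply: SH_mean_ge1; rewrite ?Xn.
by apply/separatesP => x y _ _; rewrite !modn_small // => /val_inj.
Qed.

(** Here s plays the role of the integer square root of u. At most s moduli are <= s. A larger one
    that fails to separate [X] divides some x - y > 0 with quotient q <= s, so it is recovered from
    the triple (x, y, q). *)
Lemma card_non_separating u n s Q (X : {set 'I_u}) : #|X| = n ->
  (u < s.+1 ^ 2)%N ->
  (#|[set k : 'I_Q.+1 | (0 < k)%N && ~~ ((s < k)%N && separates k X)]|
    <= (n ^ 2).+1 * s)%N.
Proof.
move=> Xn us.
pose A1 := [set (inord j.+1 : 'I_Q.+1) | j : 'I_s].
pose g (p : 'I_u * 'I_u * 'I_s) : 'I_Q.+1 := inord ((p.1.1 - p.1.2) %/ p.2.+1).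
pose A2 := g @: finset.setX (finset.setX X X) [set: 'I_s].
apply: (@leq_trans (#|A1| + #|A2|)); last first.
  rewrite mulSn leq_add //.
    by rewrite -[X in (_ <= X)%N]card_ord leq_imset_card.
  apply: leq_trans (leq_imset_card _ _) _.
  by rewrite !cardsX Xn cardsT card_ord.
apply: leq_trans (leq_card_setU _ _); apply/subset_leq_card/fintype.subsetP => k.
rewrite !inE negb_and -leqNgt => /andP[k0 /orP[ks|]].
  apply/orP; left; apply/imsetP.
  have k1s : (k.-1 < s)%N by rewrite prednK.
  by exists (Ordinal k1s) => //=; rewrite prednK // inord_val.
have [ks _|sk nsep] := leqP k s.
  apply/orP; left; apply/imsetP.
  have k1s : (k.-1 < s)%N by rewrite prednK.
  by exists (Ordinal k1s) => //=; rewrite prednK // inord_val.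
apply/orP; right.
have [x [y [xX yX yx kxy]]] : exists x y : 'I_u,
    [/\ x \in X, y \in X, (y < x)%N & (k %| x - y)%N].
  move: nsep; rewrite negb_forall_in => /exists_inP[x xX].
  rewrite negb_forall_in => /exists_inP[y yX]; rewrite negb_imply => /andP[xy nxy].
  have [xley|yltx] := leqP x y.
    exists y, x; split=> //; first by rewrite ltn_neqAle xley andbT.
    by rewrite -eqn_mod_dvd // eq_sym.
  exists x, y; split=> //; rewrite -eqn_mod_dvd // 1?ltnW //.
have xy0 : (0 < x - y)%N by rewrite subn_gt0.
have q0 : (0 < (x - y) %/ k)%N by rewrite divn_gt0 // dvdn_leq.
have qs : ((x - y) %/ k <= s)%N.
  rewrite -ltnS ltn_divLR //.
  apply: leq_trans (leq_ltn_trans (leq_subr _ _) (ltn_trans (ltn_ord x) us)) _.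
  by rewrite leq_mul2l.
have q1s : (((x - y) %/ k).-1 < s)%N by rewrite prednK.
apply/imsetP; exists (x, y, Ordinal q1s); first by rewrite !inE /= xX yX.
have dk : ((x - y) %/ ((x - y) %/ k) = k)%N by rewrite -{1}(divnK kxy) mulKn.
by rewrite /g /= prednK // dk inord_val.
Qed.

Lemma dist_frac_le (a e b : R) (c k x : nat) : 0 <= e ->
  `|a - c%:R / k%:R| <= e -> x%:R * e <= b ->
  `|a * x%:R / 1%:R - c%:R * x%:R / k%:R| <= b.
Proof.
move=> e0 ae; apply: le_trans.
rewrite divr1 [c%:R * _]mulrC -mulrA mulrC -mulrBr normrM ger0_norm //.
exact: ler_wpM2l.
Qed.

(** The constant is 6 + 8. A good k contributes at most 3 k M_max times the arc length 2/(k Q), and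
    there are at most Q of them. A bad k has k + 1 <= 2k arcs of weight n, so contributes at most
    4n/Q, and there are at most 2u of them. *)
Lemma RealH_mean_le_M_max u n (X : {set 'I_u}) :
  (1 < n)%N -> (n ^ 6 <= u)%N -> #|X| = n -> RealH_mean R n X <= 14 * M_max R u n.
Proof.
move=> n1 n6u Xn; have n0 := ltnW n1.
have n6 : (n ^ 6 = n ^ 3 * n ^ 3)%N by rewrite -expnD.
have n30 : (0 < n ^ 3)%N by rewrite expn_gt0 n0.
have u0 : (0 < u)%N by apply: leq_trans n6u; rewrite n6 muln_gt0 n30.
have nu : (n <= u)%N by apply: leq_trans n6u; rewrite -{1}(expn1 n) leq_pexp2l.
have M1 := M_max_ge1 n1 nu.
have u0' : 0 < u%:R :> R by rewrite ltr0n.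
have n0' : 0 < n%:R :> R by rewrite ltr0n.
pose s := Num.truncn (Num.sqrt (u%:R : R)).
have /andP[s_le s_lt] := truncn_itv (sqrtr_ge0 (u%:R : R)).
rewrite -/s in s_le s_lt.
have su : (s * s <= u)%N.
  rewrite -(ler_nat R) natrM -[leRHS](sqr_sqrtr (ltW u0')) expr2.
  by apply: ler_pM.
have us : (u < s.+1 ^ 2)%N.
  by rewrite -(ltr_nat R) natrX -[ltLHS](sqr_sqrtr (ltW u0')) ltr_pXn2r ?nnegrE ?sqrtr_ge0.
(* This is where u >= n^6 enters: it gives (n^2 + 1) s <= 2 s^2 <= 2u. *)
have ns : (n ^ 3 <= s)%N.
  rewrite -ltnS -(ltn_exp2r _ _ (isT : 0 < 2)%N); apply: leq_ltn_trans us.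
  by rewrite -expnM.
pose Q := (n * u)%N; have Q0 : (0 < Q)%N by rewrite muln_gt0 n0.
have Q0' : 0 < Q%:R :> R by rewrite ltr0n.
pose good k := (s < k)%N && separates k X.
pose ML k c : R := (maxload n (hash k n (c%:R : R)) X)%:R.
pose P1 (k : 'I_Q.+1) := (0 < k)%N.
(* For good k the numerators match the multipliers of [SH_mean]; c = k cannot occur, as it is not
   coprime to k > s >= 1. *)
pose P2 (k c : 'I_Q.+1) := if good k then coprime c k && (c < k)%N else (c < k.+1)%N.
pose w1 (k c : nat) : R := if good k then 3 * ML k c else n%:R.
pose P (i : 'I_Q.+1 * 'I_Q.+1) := P1 i.1 && P2 i.1 i.2.
pose w (i : 'I_Q.+1 * 'I_Q.+1) := w1 i.1 i.2.
pose e (k : nat) : R := (k%:R * Q%:R)^-1.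
pose l (i : 'I_Q.+1 * 'I_Q.+1) : R := i.2%:R / i.1%:R - e i.1.
pose r (i : 'I_Q.+1 * 'I_Q.+1) : R := i.2%:R / i.1%:R + e i.1.
have e0 k : 0 <= e k by rewrite invr_ge0 mulr_ge0.
have w0 i : P i -> 0 <= w i.
  by move=> _; rewrite /w /w1; case: ifP => // _; rewrite mulr_ge0.
apply: (@le_trans _ _ (\sum_(i | P i) w i * (r i - l i))).
  apply: RealH_mean_le => // [i _|a a01].
    by rewrite /l /r; have := e0 i.1; lra.
  have [k [c [/andP[k0 kQ] ck cop ac]]] := dirichlet_approx_coprime a01 Q0.
  have kQ1 : (k < Q.+1)%N by [].
  have cQ1 : (c < Q.+1)%N by rewrite ltnS (leq_trans ck).
  pose i0 : 'I_Q.+1 * 'I_Q.+1 := (Ordinal kQ1, Ordinal cQ1).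
  have Pi0 : P i0.
    rewrite /P /P1 /P2 /= k0 /=; case: ifP => [/andP[sk _]|_]; last by rewrite ltnS.
    rewrite cop /= ltn_neqAle ck andbT; apply: contraTneq cop => ->.
    by rewrite /coprime gcdnn; apply/eqP; lia.
  rewrite (bigD1 i0) //=; apply: ler_wpDr.
    by apply: sumr_ge0 => i /andP[Pi _]; rewrite mulr_ge0 // w0.
  have -> : \1_(`[l i0, r i0]%classic) a = 1 :> R.
    rewrite indicE mem_set //= in_itv /= /l /r /=.
    by move: ac; rewrite ler_norml -/(e k) => /andP[]; lra.
  rewrite mulr1 /w /w1 /=; case: ifP => _; last by rewrite ler_nat -Xn maxload_le_card.
  rewrite /ML -natrM ler_nat; apply: maxload_hash_close => // x _.
  apply: dist_frac_le (e0 k) ac _.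
  apply: (@le_trans _ _ (u%:R * e k)); first by apply: ler_wpM2r => //; rewrite ler_nat ltnW.
  rewrite /e /Q natrM !invfM mulrCA [_^-1 * _]mulrC mulrA mulrAC -mulrA [_ * u%:R]mulrC.
  rewrite [u%:R * _]mulrA divff ?lt0r_neq0 // mul1r ler_piMl ?invr_ge0 ?ler0n //.
  by rewrite invf_le1 ?ltr0n // ler1n.
rewrite /P -(pair_big_dep P1 P2 (fun k c : 'I_Q.+1 => w1 k c * (r (k, c) - l (k, c)))) /=.
have rl (k c : 'I_Q.+1) : r (k, c) - l (k, c) = 2 * e k by rewrite /r /l /=; ring.
pose B : {set 'I_Q.+1} := [set k : 'I_Q.+1 | (0 < k)%N && ~~ good k].
apply: (@le_trans _ _ (\sum_(k < Q.+1 | (0 < k)%N)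
   (6 / Q%:R * M_max R u n + (if k \in B then 4 * n%:R / Q%:R else 0)))).
  apply: ler_sum => k; rewrite /P1 => k0; rewrite inE k0 /=.
  have k0' : 0 < k%:R :> R by rewrite ltr0n.
  have kQ : (k <= Q)%N by rewrite -ltnS.
  under eq_bigr do rewrite rl.
  rewrite -mulr_suml /P2 /w1; case gk: (good k) => /=.
    rewrite addr0 -(@big_ord_widen_cond _ _ _ k Q.+1 (fun c => coprime c k)
      (fun c => 3 * ML k c)) 1?ltnW //.
    rewrite -mulr_sumr sum_maxload_units //.
    have MS : SH_mean R k n X <= M_max R u n.
      have /andP[sk sep] := gk.
      apply: le_trans (SH_mean_le_M_SH k0 n0 Xn sep) (M_SH_le_M_max kQ _).
      by apply: lt_le_trans s_lt _; rewrite ler_nat.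
    have tk : (totient k)%:R <= k%:R :> R.
      by rewrite -card_units ler_nat -[leqRHS]card_ord max_card.
    apply: (@le_trans _ _ (3 * (k%:R * M_max R u n) * (2 * e k))).
      apply: ler_wpM2r; first by rewrite mulr_ge0.
      apply: ler_wpM2l => //; apply: ler_pM => //.
      by apply: le_trans ler01 (SH_mean_ge1 k0 n0 _); rewrite Xn.
    by rewrite le_eqVlt; apply/orP; left; apply/eqP; rewrite /e; field; rewrite !lt0r_neq0.
  rewrite -(@big_ord_widen_cond _ _ _ k.+1 Q.+1 xpredT (fun=> n%:R)) //.
  rewrite sumr_const card_ord -(mulr_natr n%:R).
  apply: (@le_trans _ _ (n%:R * (2 * k%:R) * (2 * e k))).
    apply: ler_wpM2r; first by rewrite mulr_ge0.
    by apply: ler_wpM2l => //; rewrite -natrM ler_nat; lia.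
  have -> : n%:R * (2 * k%:R) * (2 * e k) = 4 * n%:R / Q%:R.
    by rewrite /e; field; rewrite !lt0r_neq0.
  by rewrite lerDr !mulr_ge0 ?invr_ge0 // (le_trans ler01).
rewrite big_split /=.
have -> : \sum_(k < Q.+1 | (0 < k)%N) (6 / Q%:R * M_max R u n) = 6 * M_max R u n.
  rewrite big_mkcond big_ord_recl /= add0r sumr_const card_ord -(mulr_natr (_ * _)).
  by field; rewrite !lt0r_neq0.
rewrite -big_mkcondr (eq_bigl (fun k : 'I_Q.+1 => k \in B)) => [|k]; last first.
  by rewrite inE; case: (0 < k)%N.
rewrite sumr_const -(mulr_natr (_ / _)).
have cardB : (#|B| <= 2 * u)%N.
  apply: leq_trans (card_non_separating Q Xn us) _.
  apply: (@leq_trans (2 * s * s)); last by rewrite -mulnA leq_mul2l.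
  rewrite leq_mul2r; apply/orP; right; apply: leq_trans (_ : 2 * n ^ 3 <= _)%N.
    by apply: leq_trans (leq_pmull _ _) => //; rewrite ltn_exp2l.
  by rewrite leq_mul2l.
have : 4 * n%:R / Q%:R * #|B|%:R <= 4 * n%:R / Q%:R * (2 * u%:R) :> R.
  by apply: ler_wpM2l; rewrite ?mulr_ge0 ?invr_ge0 // -natrM ler_nat.
have -> : 4 * n%:R / Q%:R * (2 * u%:R) = 8 :> R.
  by rewrite /Q natrM; field; rewrite !lt0r_neq0.
lra.
Qed.

Lemma M_RealH_le u n : (1 < n)%N -> (n ^ 6 <= u)%N -> M_RealH R u n <= 14 * M_max R u n.
Proof.
move=> n1 n6u; apply: bigmax_le => [|X /eqP Xn]; last exact: RealH_mean_le_M_max.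
rewrite mulr_ge0 // (le_trans ler01) // M_max_ge1 //.
apply: leq_trans n6u; by rewrite -{1}(expn1 n) leq_pexp2l // ltnW.
Qed.

End UpperBound.

(** * Lower bound *)

Section LowerBound.
Variable R : realType.
Implicit Types (u n k m : nat).

Lemma coprime_frac_inj (c k c' k' : nat) : coprime c k -> coprime c' k' ->
  (0 < k)%N -> (c * k' = c' * k)%N -> c = c' /\ k = k'.
Proof.
move=> ck c'k' k0 E.
have kk' : k = k'.
  apply/eqP; rewrite eqn_dvd; apply/andP; split.
    by rewrite -(@Gauss_dvdr k c) 1?coprime_sym // E dvdn_mull.
  by rewrite -(@Gauss_dvdr k' c') 1?coprime_sym // -E dvdn_mull.
split=> //; apply/eqP; rewrite -(eqn_pmul2r k0) -E kk'; exact/eqP.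
Qed.

(** Distinct reduced fractions with denominators <= m differ by at least 1/m^2, twice the arc length
    2 rho = 1/(2 m^2). The factor 6 m^2 is 3/(2 rho). The modulus 1 is left out because its only arc
    would be centred at 0. *)
Lemma sum_maxload_le_RealH m n (X : {set 'I_m}) : (0 < n)%N -> (n <= m)%N ->
  \sum_(k < m.+1 | (1 < k)%N) \sum_(c < k | coprime c k)
     (maxload n (hash k n (c%:R : R)) X)%:R <= 6 * m%:R ^+ 2 * RealH_mean R n X.
Proof.
move=> n0 nm; have m0 : (0 < m)%N by exact: leq_trans nm.
have m0' : 0 < m%:R :> R by rewrite ltr0n.
have n0' : 0 < n%:R :> R by rewrite ltr0n.
pose ML k c : R := (maxload n (hash k n (c%:R : R)) X)%:R.
pose P1 (k : 'I_m.+1) := (1 < k)%N.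
pose P2 (k c : 'I_m.+1) := coprime c k && (c < k)%N.
pose P (i : 'I_m.+1 * 'I_m.+1) := P1 i.1 && P2 i.1 i.2.
pose rho : R := (4 * m%:R ^+ 2)^-1.
have m2 : 0 < m%:R ^+ 2 :> R by rewrite exprn_gt0.
have rho0 : 0 < rho by rewrite invr_gt0 mulr_gt0.
have rhom : rho * m%:R ^+ 2 * 4 = 1 by rewrite /rho; field; rewrite lt0r_neq0.
have rhom1 : rho < m%:R^-1.
  rewrite /rho ltf_pV2 ?posrE ?mulr_gt0 // expr2 mulrA ltr_pMl //.
  by rewrite -natrM ltr1n; lia.
have frac_itv i : P i -> m%:R^-1 <= (i.2%:R / i.1%:R : R) <= 1 - m%:R^-1.
  case: i => k c; rewrite /P /P1 /P2 /= => /andP[k1 /andP[ck c_lt_k]].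
  have k0' : 0 < k%:R :> R by rewrite ltr0n ltnW.
  have c0 : (0 < c)%N.
    by case: posnP ck k1 => // ->; rewrite /coprime gcd0n => /eqP ->.
  have km : m%:R^-1 <= k%:R^-1 :> R.
    by rewrite lef_pV2 ?posrE // ler_nat -ltnS.
  apply/andP; split.
    by apply: le_trans km _; rewrite ler_peMl ?invr_ge0 // ler1n.
  apply: (@le_trans _ _ (1 - k%:R^-1)); last exact: lerB.
  by rewrite lerBrDr -[X in _ + X]mul1r -mulrDl ler_pdivrMr // mul1r natr1 ler_nat.
pose w (i : 'I_m.+1 * 'I_m.+1) : R := ML i.1 i.2 / 3.
pose l (i : 'I_m.+1 * 'I_m.+1) : R := i.2%:R / i.1%:R - rho.
pose r (i : 'I_m.+1 * 'I_m.+1) : R := i.2%:R / i.1%:R + rho.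
have disj (a : R) i j : P i -> P j -> l i <= a <= r i -> l j <= a <= r j -> i = j.
  move: i j => [k c] [k' c']; rewrite /P /P1 /P2 /l /r /=.
  move=> /andP[k1 /andP[ck c_lt_k]] /andP[k'1 /andP[c'k' c'_lt_k']] /andP[? ?] /andP[? ?].
  have k0' : 0 < k%:R :> R by rewrite ltr0n ltnW.
  have k'0' : 0 < k'%:R :> R by rewrite ltr0n ltnW.
  have close : `|c%:R / k%:R - c'%:R / k'%:R| <= 2 * rho by rewrite ler_norml; lra.
  have kk'm : k%:R * k'%:R <= m%:R ^+ 2 :> R.
    by rewrite expr2 ler_pM // ler_nat -ltnS.
  have det : `|(c * k')%:Z%:~R - (c' * k)%:Z%:~R : R| < 1.
    rewrite -!pmulrn.
    have -> : (c * k')%:R - (c' * k)%:R = (c%:R / k%:R - c'%:R / k'%:R) * (k%:R * k'%:R) :> R.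
      by rewrite !natrM; field; rewrite !lt0r_neq0.
    rewrite normrM [`|k%:R * _|]ger0_norm ?mulr_ge0 //.
    apply: (@le_lt_trans _ _ (2 * rho * m%:R ^+ 2)); first exact: ler_pM.
    lra.
  (* An integer of absolute value below 1 is 0. *)
  have E : (c * k' = c' * k)%N.
    move: det; rewrite -intrB -intr_norm -[1]/(1%:~R) ltr_int; lia.
  have [cc' kk'] := coprime_frac_inj ck c'k' (ltnW k1) E.
  by congr (_, _); apply/val_inj.
have : \sum_(i | P i) w i * (r i - l i) <= RealH_mean R n X.
  apply: RealH_mean_ge => // [i _|i Pi|a a01].
  - by rewrite divr_ge0.
  - by have /andP[? ?] := frac_itv i Pi; split; rewrite /l /r; lra.
  - case: (pickP (fun i => P i && (l i <= a <= r i))) => [i /andP[Pi ai]|none]; last first.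
      rewrite big1 ?ler0n // => i Pi; rewrite indicE memNset ?mulr0 //=.
      by rewrite in_itv /= => ai; have := none i; rewrite Pi ai.
    rewrite (bigD1 i) //= big1 => [|j /andP[Pj ji]]; last first.
      rewrite indicE memNset ?mulr0 //= in_itv /= => aj.
      by case/eqP: ji; exact: (disj a).
    rewrite addr0 indicE mem_set //= ?in_itv //= mulr1 /w ler_pdivrMr // mulrC.
    rewrite /ML -natrM ler_nat.
    have i10 : (0 < i.1)%N by move: Pi => /andP[/ltnW].
    apply: maxload_hash_close => // x _; rewrite distrC.
    apply: (@dist_frac_le _ _ rho) => //; first exact: ltW.
      by move: ai; rewrite /l /r ler_norml => /andP[? ?]; lra.
    apply: (@le_trans _ _ (m%:R * rho)).
      by apply: ler_wpM2r; [exact: ltW | rewrite ler_nat ltnW].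
    apply: (@le_trans _ _ m%:R^-1); last by rewrite lef_pV2 ?posrE // ler_nat.
    by rewrite -[m%:R^-1]mul1r ler_pdivlMr //; lra.
rewrite /P -(pair_big_dep P1 P2 (fun k c : 'I_m.+1 => w (k, c) * (r (k, c) - l (k, c)))) /=.
move=> le_RealH.
have m26 : 0 <= 6 * m%:R ^+ 2 :> R by rewrite mulr_ge0 // ltW.
apply: le_trans (ler_wpM2l m26 le_RealH).
rewrite mulr_sumr; apply: ler_sum => k k1; rewrite mulr_sumr /P2.
rewrite (@big_ord_widen_cond _ _ _ k m.+1 (fun c => coprime c k) (fun c => ML k c)) 1?ltnW //.
apply: ler_sum => c _; rewrite /w /r /l /=.
have -> : c%:R / k%:R + rho - (c%:R / k%:R - rho) = 2 * rho by ring.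
have -> : 6 * m%:R ^+ 2 * (ML k c / 3 * (2 * rho)) = ML k c * (rho * m%:R ^+ 2 * 4).
  by field.
by rewrite rhom mulr1.
Qed.

(** The m - j with j <= m/2 are all admissible. *)
Lemma card_moduli m : (m <= 2 * #|moduli m|)%N.
Proof.
pose f (j : 'I_(m./2).+1) : 'I_m.+1 := inord (m - j).
have fE j : f j = (m - j)%N :> nat by rewrite inordK // ltnS leq_subr.
have : (#|f @: [set: 'I_(m./2).+1]| <= #|moduli m|)%N.
  apply/subset_leq_card/fintype.subsetP => _ /imsetP[j _ ->].
  by rewrite inE fE; have := ltn_ord j; lia.
rewrite card_imset ?cardsT ?card_ord; first by lia.
move=> i j /(congr1 val); rewrite /= !fE => ij; apply/val_inj => /=.
by have := ltn_ord i; have := ltn_ord j; lia.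
Qed.

(** For k >= m/2 the mean over c is at most (2 L/m) times the sum over c. Multiplying by 6 m^2 and
    dividing by at least m/2 moduli gives 24 L. *)
Lemma RMH_mean_le_RealH m n (X : {set 'I_m}) (L : R) :
  (0 < n)%N -> (n <= m)%N -> (3 < m)%N ->
  (forall k, (0 < k <= m)%N -> k%:R <= L * (totient k)%:R) ->
  RMH_mean R m n X <= 24 * L * RealH_mean R n X.
Proof.
move=> n0 nm m3 tot; have m0' : 0 < m%:R :> R by rewrite ltr0n; lia.
have L0 : 0 <= L.
  have m1 : (0 < 1 <= m)%N by lia.
  by have := tot _ m1; rewrite -[totient 1]/1%N mulr1; exact: le_trans.
have card0 : 0 < #|moduli m|%:R :> R by rewrite ltr0n; have := card_moduli m; lia.
rewrite /RMH_mean /unif_mean ler_pdivrMr //.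
pose S k : R := \sum_(c < k | coprime c k) (maxload n (hash k n (c%:R : R)) X)%:R.
have S0 k : 0 <= S k by apply: sumr_ge0.
apply: (@le_trans _ _ (\sum_(k in moduli m) (2 * L / m%:R) * S k)).
  apply: ler_sum => k; rewrite inE => mk.
  have k0 : (0 < k)%N by lia.
  have t0 : 0 < (totient k)%:R :> R by rewrite ltr0n totient_gt0.
  rewrite -(ler_pM2l t0) -sum_maxload_units // -/(S k) mulrA ler_peMl //.
  rewrite mulrA ler_pdivlMr // mul1r.
  have kt : k%:R <= L * (totient k)%:R by apply: tot; rewrite k0 -ltnS ltn_ord.
  have : m%:R <= 2 * k%:R :> R by rewrite -natrM ler_nat.
  lra.
rewrite -mulr_sumr.
(* As m > 3, every admissible modulus exceeds 1. *)
have sub : \sum_(k in moduli m) S k <= \sum_(k < m.+1 | (1 < k)%N) S k.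
  rewrite big_mkcond [leRHS]big_mkcond; apply: ler_sum => k _; rewrite inE.
  by case: ifP => mk; [rewrite ifT //; lia | case: ifP].
have Lm0 : 0 <= 2 * L / m%:R by rewrite !mulr_ge0 // invr_ge0 ltW.
apply: le_trans (ler_wpM2l Lm0 (le_trans sub (sum_maxload_le_RealH X n0 nm))) _.
have -> : 2 * L / m%:R * (6 * m%:R ^+ 2 * RealH_mean R n X)
    = 12 * L * RealH_mean R n X * m%:R.
  by field; rewrite lt0r_neq0.
have -> : 24 * L * RealH_mean R n X * #|moduli m|%:R
    = 12 * L * RealH_mean R n X * (2 * #|moduli m|%:R) by ring.
apply: ler_wpM2l; last by rewrite -natrM ler_nat card_moduli.
rewrite !mulr_ge0 // /RealH_mean; apply: Rintegral_ge0 => a _.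
exact: ler0n.
Qed.

End LowerBound.

(** * Passage to the maxima and choice of constants *)

Lemma RealH_mean_widen (R : realType) m u n (X : {set 'I_m}) (mu : (m <= u)%N) :
  RealH_mean R n X = RealH_mean R n (widen_ord mu @: X).
Proof.
apply: eq_Rintegral => a _; congr _%:R; apply: maxload_imset => //.
by move=> x y _ _ /(congr1 val) /= /val_inj.
Qed.

Lemma M_RMH_le (R : realType) m u n (L : R) :
  (0 < n)%N -> (n <= m)%N -> (3 < m)%N -> (m <= u)%N ->
  (forall k, (0 < k <= m)%N -> k%:R <= L * (totient k)%:R) ->
  M_RMH R m n <= 24 * L * M_RealH R u n.
Proof.
move=> n0 nm m3 mu tot.
have L0 : 0 <= L.
  have m1 : (0 < 1 <= m)%N by lia.
  by have := tot _ m1; rewrite -[totient 1]/1%N mulr1; exact: le_trans.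
have M0 : 0 <= M_RealH R u n by exact: bigmax_ge_id.
apply: bigmax_le => [|X /eqP Xn]; first by rewrite !mulr_ge0.
apply: le_trans (RMH_mean_le_RealH X n0 nm m3 tot) _.
apply: ler_wpM2l; first by rewrite mulr_ge0.
rewrite (RealH_mean_widen R n X mu).
apply: (@le_bigmax_cond _ _ _ _ _ (fun Y : {set 'I_u} => #|Y| == n)).
by rewrite card_imset ?Xn // => x y /(congr1 val) /= /val_inj.
Qed.

Lemma truncn_sqrt_bounds (R : realType) (N : nat) (m := Num.truncn (Num.sqrt (N%:R : R))) :
  (m ^ 2 <= N < m.+1 ^ 2)%N.
Proof.
have /andP[lo hi] := truncn_itv (sqrtr_ge0 (N%:R : R)).
have N0 : 0 <= N%:R :> R by exact: ler0n.
rewrite -(ler_nat R) -(ltr_nat R) !natrX -(sqr_sqrtr N0).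
by rewrite ler_pXn2r ?ltr_pXn2r ?nnegrE ?sqrtr_ge0 // lo hi.
Qed.

(** Use [totient_lower_bound] with y just above E ln n, which dominates ln k. Since ln n > 2 E, y <=
    2 E ln n <= (ln n)^2, so ln y <= 2 ln ln n; hence the factor 2 in the constant. *)
Lemma totient_lower_bound_lnln (R : realType) (D : R) : exists (K : R) (n0 : nat), 0 < K /\
  forall n k : nat, (n0 <= n)%N -> (0 < k)%N -> k%:R <= n%:R `^ D ->
    0 < ln (ln n%:R) :> R /\ k%:R <= K * ln (ln n%:R) * (totient k)%:R.
Proof.
have [K [K0 tot]] := totient_lower_bound R.
pose E : R := `|D| + 2.
have E2 : 2 <= E by rewrite /E lerDr.
have E0 : 0 < E by lra.
exists (2 * K), (Num.truncn (expR (2 * E))).+1; split; first by rewrite mulr_gt0.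
move=> n k n0n k0 kn.
have expn : expR (2 * E) < n%:R.
  have /andP[_ hi] := truncn_itv (expR_ge0 (2 * E)).
  by apply: lt_le_trans hi _; rewrite ler_nat.
have n0 : 0 < n%:R :> R by apply: lt_trans expn; exact: expR_gt0.
have L4 : 2 * E < ln n%:R by rewrite -ltr_expR lnK.
have L0 : 0 < ln n%:R :> R by lra.
have LL0 : 0 < ln (ln n%:R) :> R by apply: ln_gt0; lra.
split=> //.
pose y := (Num.truncn (E * ln n%:R)).+1.
have EL0 : 0 <= E * ln n%:R by rewrite mulr_ge0 // ltW.
have EL : 8 <= E * ln n%:R by apply: le_trans (ler_pM _ _ E2 (_ : 4 <= _)) => //; lra.
have /andP[ylo yhi] := truncn_itv EL0; rewrite -/y in yhi.
have y2 : (2 < y)%N by rewrite -(ltr_nat R); lra.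
have ky : ln k%:R <= y%:R :> R.
  apply: le_trans (ltW yhi); apply: (@le_trans _ _ (D * ln n%:R)).
    rewrite -ln_powR ler_ln ?posrE ?ltr0n ?powR_gt0 //.
  apply: ler_wpM2r; first exact: ltW.
  by rewrite /E; have := ler_norm D; lra.
apply: le_trans (tot _ _ k0 y2 ky) _; apply: ler_wpM2r => //.
rewrite -mulrA mulrCA; apply: ler_wpM2l; first exact: ltW.
have yL : y%:R <= ln n%:R * ln n%:R :> R.
  apply: (@le_trans _ _ (2 * E * ln n%:R)); last by rewrite ler_pM2r // ltW.
  by rewrite /y -natr1; lra.
have y0 : 0 < y%:R :> R by lra.
apply: (@le_trans _ _ (ln (ln n%:R * ln n%:R))).
  by rewrite ler_ln ?posrE ?mulr_gt0.
by rewrite lnM ?posrE //; lra.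
Qed.

Theorem mainTheorem4 (R : realType) (C : R) :
  exists (c1 c2 : R) (n0 : nat),
    0 < c1 /\ 0 < c2 /\
    forall n u : nat,
      (n0 <= n)%N -> (n ^ 6 <= u)%N -> u%:R <= n%:R `^ C ->
      c1 * (M_RMH R (Num.truncn (Num.sqrt (n * u)%:R : R)) n / ln (ln n%:R))
        <= M_RealH R u n
      /\ M_RealH R u n <= c2 * M_max R u n.
Proof.
(* The exponent comes from k <= m <= n u <= n^(1 + C). *)
have [K [n0 [K0 tot]]] := totient_lower_bound_lnln (1 + C).
(* The 24 comes from [M_RMH_le] with L = K ln ln n, the 14 from [M_RealH_le]; n >= 4 ensures m >
   3. *)
exists (24 * K)^-1, 14, (maxn 4 n0).
split; first by rewrite invr_gt0 mulr_gt0.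
split=> // n u; rewrite geq_max => /andP[n4 n0n] n6u uC.
split; last by apply: M_RealH_le => //; lia.
have n_gt0 : (0 < n)%N by lia.
have nu : (n <= u)%N by apply: leq_trans n6u; rewrite -{1}(expn1 n) leq_pexp2l.
set m := Num.truncn _.
have /andP[m_le m_lt] := truncn_sqrt_bounds R (n * u).
rewrite -/m in m_le m_lt.
have nm : (n <= m)%N.
  rewrite -ltnS -(ltn_exp2r _ _ (isT : 0 < 2)%N); apply: leq_ltn_trans m_lt.
  by rewrite leq_mul2l nu orbT.
have mu : (m <= u)%N.
  rewrite -(leq_exp2r _ _ (isT : 0 < 2)%N); apply: leq_trans m_le _.
  by rewrite leq_mul2r nu orbT.
have mnu : (m <= n * u)%N by apply: leq_trans m_le; rewrite leq_pmull //; lia.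
have bound k : (0 < k <= m)%N ->
    0 < ln (ln n%:R) :> R /\ k%:R <= K * ln (ln n%:R) * (totient k)%:R.
  move=> /andP[k0 km]; apply: tot => //.
  apply: (@le_trans _ _ (n * u)%:R); first by rewrite ler_nat (leq_trans km).
  by rewrite natrM powRD ?powRr1 ?ler_wpM2l // pnatr_eq0 -lt0n n_gt0 implybT.
have m1 : (0 < 1 <= m)%N by lia.
have [LL0 _] := bound _ m1.
have := M_RMH_le n_gt0 nm (leq_trans n4 nm) mu (fun k km => (bound k km).2).
rewrite mulrA [24 * K * _]mulrC -mulrA => le_M.
rewrite ler_pdivrMl ?mulr_gt0 // ler_pdivrMr // mulrC; exact: le_M.
Qed.
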